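(* Let $d\geq 2$ be an integer and let $K\subset\mathbb{R}^n$ be a nonempty set represented by $$K=\{x\in\mathbb{R}^n: q_1(x)\leq 0,\dots,q_m(x)\leq 0\},$$ where $q_1,\dots,q_m$ are convex polynomials. Assume that the asymptotic cone $K_\infty$ is represented by $K_\infty=\{x\in\mathbb{R}^n: Ax\geq 0\}$, where $A\in\mathbb{R}^{p\times n}$ is full rank. Then the set $\mathcal{R}_d$ of all polynomials $g$ in $n$ variables of degree $d$ such that $\mathrm{OP}(K,g)$ is regular is generic in $\mathbb{R}_d[x]$.
   Context: $\mathrm{OP}(K,g)$ denotes the problem of minimizing $g(x)$ subject to $x\in K$; for a closed set $S$ and polynomial $h$, $\mathrm{Sol}(S,h)$ denotes the set of (global) minimizers of $h$ over $S$. The asymptotic cone of a nonempty closed set $S\subset\mathbb{R}^n$ is $S_\infty=\{v\in\mathbb{R}^n:\exists t_k\to+\infty,\ \exists x_k\in S \text{ with } \lim_{k\to\infty} x_k/t_k=v\}$. For a polynomial $g$ of degree $d$, $g_d$ denotes its homogeneous component of degree $d$, and $\mathrm{OP}(K,g)$ is called regular if $\mathrm{Sol}(K_\infty,g_d)$ is bounded (the empty set counts as bounded). $\mathbb{R}_d[x]$ is the finite-dimensional space of all real polynomials in $n$ variables of degree at most $d$, with the topology of the $\ell_2$-norm on coefficient vectors. A subset of a topological space is generic if it contains a countable intersection of dense and open sets. The inequality $Ax\geq 0$ is componentwise. *)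

(* Defs.v *)
From HB Require Import structures.
From mathcomp Require Import all_boot all_order all_algebra.
(* mpoly must be imported before the analysis files: the reverse order makes
   the parsing levels of their notations clash. *)
From mathcomp Require Import mpoly.
From mathcomp Require Import ring.
From mathcomp Require Import all_classical all_reals all_analysis.

Set Implicit Arguments.
Unset Strict Implicit.
Unset Printing Implicit Defensive.

Import Order.TTheory GRing.Theory Num.Theory.
Import numFieldNormedType.Exports.

Local Open Scope classical_set_scope.
Local Open Scope ring_scope.

Section PolyDegLe.
Variables (R : realType) (n d : nat).

Definition deg_le : {pred {mpoly R[n]}} := [pred p | (msize p <= d.+1)%N].

Lemma deg_leP (p : {mpoly R[n]}) :
  reflect (forall m : 'X_{1..n}, (d < mdeg m)%N -> p@_m = 0) (p \in deg_le).
Proof.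
apply: (iffP idP) => [le_p m lt_m | p0].
  by apply/memN_msupp_eq0/msize_mdeg_ge/(leq_trans le_p).
rewrite inE mmeasureE; apply/bigmax_leqP_seq => m; rewrite mcoeff_msupp => pm _.
by rewrite ltnS leqNgt; apply: contra pm => /p0 ->.
Qed.

Lemma deg_le_submod : submod_closed deg_le.
Proof.
split=> [|a u v /deg_leP u0 /deg_leP v0]; apply/deg_leP => m lt_m.
  by rewrite mcoeff0.
by rewrite mcoeffD mcoeffZ u0 // v0 // mulr0 addr0.
Qed.

HB.instance Definition _ :=
  GRing.isSubmodClosed.Build R {mpoly R[n]} deg_le deg_le_submod.

(* The space R_d[x] of polynomials of degree at most d. *)
Record poly_le := PolyLe {
  poly_le_val :> {mpoly R[n]};
  poly_leP : poly_le_val \in deg_le }.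

HB.instance Definition _ := [isSub for poly_le_val].
HB.instance Definition _ := [Choice of poly_le by <:].
HB.instance Definition _ := [SubChoice_isSubLmodule of poly_le by <:].

Definition l2norm (p : poly_le) : R :=
  Num.sqrt (\sum_(m : 'X_{1..n < d.+1}) (poly_le_val p)@_m ^+ 2).

Lemma l2norm_ge0 p : 0 <= l2norm p.
Proof. exact: sqrtr_ge0. Qed.

Lemma l2norm_sqr p :
  l2norm p ^+ 2 = \sum_(m : 'X_{1..n < d.+1}) (poly_le_val p)@_m ^+ 2.
Proof. by rewrite sqr_sqrtr // sumr_ge0 // => m _; apply: sqr_ge0. Qed.

Lemma l2norm_eq0 p : l2norm p = 0 -> p = 0.
Proof.
move=> p0; have /eqP := l2norm_sqr p.
rewrite p0 expr0n /= eq_sym psumr_eq0 => [/allP /= s0|m _]; last exact: sqr_ge0.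
apply/val_inj/mpolyP => m /=; rewrite mcoeff0.
have [lt_m|] := ltnP d (mdeg m); first exact/deg_leP/lt_m/poly_leP.
rewrite -ltnS => lt_m.
have := s0 (BMultinom lt_m); rewrite mem_index_enum sqrf_eq0 /= => /(_ isT).
by move=> /eqP.
Qed.

Lemma l2normZ a p : l2norm (a *: p) = `|a| * l2norm p.
Proof.
rewrite -sqrtr_sqr /l2norm -sqrtrM ?sqr_ge0 //; congr Num.sqrt.
by rewrite mulr_sumr; apply: eq_bigr => m _; rewrite mcoeffZ exprMn.
Qed.

Lemma l2norm_triangle p q : l2norm (p + q) <= l2norm p + l2norm q.
Proof.
have [->|p0] := eqVneq p 0; first by rewrite add0r lerDr l2norm_ge0.
have [->|q0] := eqVneq q 0; first by rewrite addr0 lerDl l2norm_ge0.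
have gt0 r : r != 0 -> 0 < l2norm r.
  by move=> r0; rewrite lt0r l2norm_ge0 andbT; apply: contra r0 => /eqP/l2norm_eq0 ->.
have a0 := gt0 _ p0; have b0 := gt0 _ q0.
set a := l2norm p in a0 *; set b := l2norm q in b0 *.
rewrite -(@ler_pXn2r _ 2) ?nnegrE ?addr_ge0 ?l2norm_ge0 //.
have -> : (a + b) ^+ 2 =
    \sum_(m : 'X_{1..n < d.+1}) ((1 + b / a) * (poly_le_val p)@_m ^+ 2 +
                                 (1 + a / b) * (poly_le_val q)@_m ^+ 2).
  rewrite big_split /= -!mulr_sumr -!l2norm_sqr -/a -/b.
  by field; rewrite !gt_eqF.
rewrite l2norm_sqr; apply: ler_sum => m _; rewrite mcoeffD.
set x := _@__; set y := _@__; rewrite -subr_ge0.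
have -> : (1 + b / a) * x ^+ 2 + (1 + a / b) * y ^+ 2 - (x + y) ^+ 2 =
    (b * x - a * y) ^+ 2 / (a * b).
  by field; rewrite !gt_eqF.
by rewrite divr_ge0 ?sqr_ge0 // mulr_ge0 // ltW.
Qed.

HB.instance Definition _ :=
  Lmodule_isNormed.Build R poly_le l2norm_triangle l2normZ l2norm_eq0.

End PolyDegLe.

Section Optimization.
Variables (R : realType) (n : nat).
Implicit Types (K S : set 'cV[R]_n) (g h : {mpoly R[n]}).

Definition peval h (x : 'cV[R]_n) : R := h.@[fun i => x i 0].

Definition Sol S h : set 'cV[R]_n :=
  [set x | S x /\ forall y, S y -> peval h x <= peval h y].

Definition asymptotic_cone S : set 'cV[R]_n :=
  [set v | exists (t : nat -> R) (x : nat -> 'cV[R]_n),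
    [/\ t k @[k --> \oo] --> +oo,
        forall k, S (x k) &
        (t k)^-1 *: x k @[k --> \oo] --> v]].

(* msize is the degree plus one. *)
Definition lead_form g : {mpoly R[n]} := pihomog mdeg (msize g).-1 g.

Definition regular K g := bounded_set (Sol (asymptotic_cone K) (lead_form g)).

End Optimization.

Definition generic (T : topologicalType) (S : set T) :=
  exists U : nat -> set T,
    (forall k, open (U k) /\ dense (U k)) /\ \bigcap_k U k `<=` S.

(* Main.v *)
Require Import Defs.
From HB Require Import structures.
From mathcomp Require Import all_boot all_order all_algebra.
From mathcomp Require Import mpoly.
From mathcomp Require Import all_classical all_reals all_analysis.

Set Implicit Arguments.
Unset Strict Implicit.
Unset Printing Implicit Defensive.

Import Order.TTheory GRing.Theory Num.Theory.
Import numFieldNormedType.Exports.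

Local Open Scope classical_set_scope.
Local Open Scope ring_scope.

(** Let C be the asymptotic cone of K, let h be the degree d component of g, and
    suppose that g has degree exactly d. Since h is homogeneous, a minimizer of
    h over the cone C can only have the value 0: a negative value is lowered
    further by scaling, and h 0 = 0 forbids a positive one. So the solution set
    is empty when h takes a negative value on C, and otherwise it is the set of
    zeros of h in C. It is therefore bounded as soon as, on the intersection S
    of C with the unit sphere, either h is positive everywhere or h is negative
    somewhere ([nondegenerate_regular]).

    This dichotomy defines an open set of polynomials ([nondegenerate_open]):
    h x is Lipschitz in the coefficients of g, uniformly over the unit ball, and
    S is compact because the inequalities A x >= 0 define a closed cone, so that
    a positive h is bounded away from 0 on S. It also
    defines a dense set ([nondegenerate_dense]): if it fails for g, then h has a
    zero x in S, some coordinate x_i is nonzero, and subtracting a small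
    positive multiple of x_i^d 'X_i^d from g makes the value at x negative.

    Having degree exactly d follows from the open dense condition that one fixed
    coefficient of degree d does not vanish. The intersection of these two open
    dense sets consists of polynomials of degree d with a regular problem. *)

(** * Compact sets of column vectors *)

Lemma trmx_continuous (K : numFieldType) m n :
  continuous (trmx : 'M[K]_(m, n) -> 'M[K]_(n, m)).
Proof.
move=> x P /nbhs_ballP[e e0 eP]; apply/nbhs_ballP; exists e => // y [_ xy].
by apply: eP; split=> // i j; rewrite !mxE; exact: xy.
Qed.

Lemma ler_norm_coord (K : realDomainType) m n (x : 'M[K]_(m, n)) i j :
  `|x i j| <= `|x|.
Proof. by rewrite -[`|x|]/(mx_norm x) mx_normrE (le_bigmax _ _ (i, j)). Qed.

(** Transposition is a homeomorphism that preserves the sup norm, which reduces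
    the claim to the known one for row vectors. *)
Lemma bounded_closed_compact_cV (R : realType) n (B : set 'cV[R]_n) :
  bounded_set B -> closed B -> compact B.
Proof.
move=> bdB clB.
have -> : B = trmx @` [set y : 'rV[R]_n | B y^T].
  rewrite eqEsubset; split=> [x Bx|_ [y By <-]] //.
  by exists x^T; rewrite /= trmxK.
apply: continuous_compact.
  by apply: continuous_subspaceT => x; exact: trmx_continuous.
apply: bounded_closed_compact; last first.
  apply: (preimage_closed (D := B)) clB => x _; exact: trmx_continuous.
case/ex_strict_bound_gt0: bdB => M M0 ltM.
exists M; split=> [|N ltMN y /= /ltM /ltW le_yM]; first exact: num_real.
apply: le_trans (ltW ltMN).
rewrite -[`|y|]/(mx_norm y) mx_normrE bigmax_le ?(ltW M0) // => -[i j] _.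
by apply: le_trans le_yM; have := ler_norm_coord y^T j i; rewrite mxE.
Qed.

(** * The homogeneous component of degree d *)

Section TopForm.
Variables (R : realType) (n d : nat).
Implicit Types (g h : {mpoly R[n]}) (x : 'cV[R]_n).

(** Unlike [lead_form g], whose degree depends on g, this is linear in g; the
    two agree when g has degree exactly d. *)
Definition topform g x := peval (pihomog mdeg d g) x.

Lemma topformE g x : g \in @deg_le R n d ->
  topform g x = \sum_(m : 'X_{1..n < d.+1} | mdeg m == d)
                   g@_m * \prod_i x i 0 ^+ m i.
Proof.
move=> le_g; rewrite /topform /peval (pihomogwE _ _ le_g) raddf_sum /=.
by apply: eq_bigr => m _; rewrite mevalZ mevalX.
Qed.

Lemma topformD g h x : topform (g + h) x = topform g x + topform h x.
Proof. by rewrite /topform /peval pihomogD mevalD. Qed.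

Lemma topformB g h x : topform (g - h) x = topform g x - topform h x.
Proof. by rewrite /topform /peval pihomogB mevalB. Qed.

Lemma topformZ a g x : topform (a *: g) x = a * topform g x.
Proof. by rewrite /topform /peval linearZ mevalZ. Qed.

Lemma topform_homog g x a : topform g (a *: x) = a ^+ d * topform g x.
Proof.
rewrite /topform /peval !mevalE mulr_sumr; apply: eq_big_seq => m hm.
rewrite mulrCA; congr (_ * _).
have -> : a ^+ d = a ^+ mdeg m by rewrite (dhomog_mf (pihomogP mdeg d g) hm).
by rewrite mdegE expr_sum -big_split /=; apply: eq_bigr => i _; rewrite mxE exprMn.
Qed.

Lemma topform_pow i x : topform ('X_i ^+ d) x = x i 0 ^+ d.
Proof.
rewrite /topform mpolyXn pihomogX /= mdegMn mdeg1 mul1n eqxx -mpolyXn /peval.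
by rewrite rmorphXn /= mevalXU.
Qed.

Lemma topform_continuous g : continuous (topform g).
Proof.
rewrite /topform /peval => x.
under eq_fun do rewrite mevalE.
move: x; apply: continuous_big => [|m _].
  exact: add_continuous.
move=> x; apply: continuousM; first exact: cst_continuous.
move: x; apply: continuous_big => [|i _]; first exact: mul_continuous.
move=> x; apply: (@continuous_comp _ _ _ (fun y : 'cV[R]_n => y i 0) (fun t => t ^+ m i)).
  exact: coord_continuous.
exact: exprn_continuous.
Qed.

Lemma ler_coef_norm (g : poly_le R n d) m : `|(poly_le_val g)@_m| <= `|g|.
Proof.
have [lt_m|] := ltnP d (mdeg m).
  by rewrite (elimT (deg_leP _ _) (poly_leP g)) ?normr0.
rewrite -ltnS => le_m; rewrite -sqrtr_sqr.
rewrite ler_sqrt ?sumr_ge0 // => [|? _]; last exact: sqr_ge0.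
rewrite (bigD1 (BMultinom le_m)) //= lerDl sumr_ge0 // => ? _; exact: sqr_ge0.
Qed.

(** On the unit ball of the sup norm every monomial has absolute value at most
    1, hence a bound that does not depend on the point. *)
Lemma topform_le (g : poly_le R n d) x : `|x| <= 1 ->
  `|topform g x| <= #|{: 'X_{1..n < d.+1}}|%:R * `|g|.
Proof.
move=> x1; rewrite topformE ?poly_leP//.
apply: le_trans (ler_norm_sum _ _ _) _.
(* The constant counts all monomials, so those of lower degree pad the sum. *)
rewrite mulr_natl -sumr_const [leRHS]big_mkcond /= [leLHS]big_mkcond /=.
apply: ler_sum => m _; case: ifP => // _.
rewrite normrM -[leRHS]mulr1 ler_pM //.
  exact: ler_coef_norm.
rewrite normr_prod prodr_ile1 // => i _; rewrite normrX exprn_ge0 //=.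
by rewrite exprn_ile1 // (le_trans (ler_norm_coord _ _ _)).
Qed.

End TopForm.

(** The neighbourhood is uniform over the unit ball, as needed to perturb an
    inequality at all points of the sphere at once. *)
Lemma topform_near (R : realType) (n d : nat) (g : poly_le R n d) (c : R) :
  0 < c -> \forall g' \near g, forall x : 'cV[R]_n, `|x| <= 1 ->
    `|topform d g x - topform d (g' : poly_le R n d) x| < c.
Proof.
move=> c0; set N := #|{: 'X_{1..n < d.+1}}|%:R + 1 : R.
have N0 : 0 < N by rewrite ltr_wpDl.
apply/nbhs_normP; exists (c / N); first by rewrite /= divr_gt0.
move=> g' /=; rewrite ltr_pdivlMr // => gg' x x1.
rewrite -topformB; apply: le_lt_trans gg'.
apply: le_trans (topform_le (g - g') x1) _.
by rewrite mulrC ler_wpM2l // lerDl.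
Qed.

(** * Nondegeneracy on a cone is an open condition *)

Section Nondegenerate.
Variables (R : realType) (n d : nat) (C : set 'cV[R]_n).

Definition unit_part : set 'cV[R]_n := C `&` [set x | `|x| = 1].

(** For a cone C, the complement consists of the g whose degree d component is nonnegative on
    C and vanishes at some nonzero point of C. *)
Definition nondegenerate : set (poly_le R n d) :=
  [set g | (forall x, unit_part x -> 0 < topform d g x) \/
           exists2 x, unit_part x & topform d g x < 0].

Lemma unit_part_compact : closed C -> compact unit_part.
Proof.
move=> clC; apply: bounded_closed_compact_cV.
  exists 1; split=> [|M ltM x [_ /= ->]]; [exact: num_real|exact: ltW].
apply: closedI => //.
apply: (@preimage_closed 'cV[R]_n R (fun x => `|x|) [set 1]); last exact: closed_eq.
by move=> x _; exact: norm_continuous.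
Qed.

(** In the positive case compactness provides a minimum c > 0 over the unit part,
    which is the margin available for perturbing g; in the negative case a single
    point provides the margin. *)
Lemma nondegenerate_open : closed C -> open nondegenerate.
Proof.
move=> clC; rewrite openE => g [gpos|[x Sx gx]]; last first.
  have c0 : 0 < - topform d g x by rewrite oppr_gt0.
  apply: filterS (topform_near g c0) => g' gg'; right; exists x => //.
  case: Sx => _ /= x1; have := gg' x; rewrite x1 lexx => /(_ isT).
  by move=> /ltr_distlCDr; rewrite subrr.
have [S0|/set0P[x0 Sx0]] := eqVneq unit_part set0.
  by apply: filterE => g'; left=> x; rewrite S0.
have [|c cS cmin] := @compact_EVT_min _ _ (topform d g) _ (ex_intro _ x0 Sx0)
    (unit_part_compact clC).
  by apply: continuous_subspaceT; exact: topform_continuous.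
rewrite inE in cS.
apply: filterS (topform_near g (gpos c cS)) => g' gg'; left=> x Sx.
have := cmin x (mem_set Sx); case: Sx => _ /= x1.
have := gg' x; rewrite x1 lexx => /(_ isT) /ltr_distlDr lt_gx le_gx.
by move: (le_lt_trans le_gx lt_gx); rewrite ltrDr.
Qed.

End Nondegenerate.

(** * Density *)

Section Density.
Variables (R : realType) (n d : nat).

Lemma monomial_subproof (i : 'I_n) : ('X_i ^+ d : {mpoly R[n]}) \in @deg_le R n d.
Proof. by rewrite inE mpolyXn msizeX mdegMn mdeg1 mul1n. Qed.

Definition pow_var i : poly_le R n d := PolyLe (monomial_subproof i).

Lemma open_line (O : set (poly_le R n d)) g h : open O -> O g ->
  exists2 e : R, 0 < e & O (g + e *: h).
Proof.
move=> oO Og; have := oO; rewrite openE => /(_ _ Og) /nbhs_normP[e /= e0 eO].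
have h0 : 0 < 1 + `|h| by rewrite ltr_pwDl.
exists (e / (1 + `|h|)); first by rewrite divr_gt0.
apply: eO => /=; rewrite opprD addNKr normrN normrZ gtr0_norm ?divr_gt0 //.
by rewrite mulrAC ltr_pdivrMr // ltr_pM2l // ltrDr.
Qed.

(** At a degenerate g one zero is pushed below 0, rather than making the form
    positive on C, so that odd d and cones containing lines fit in as well. *)
Lemma nondegenerate_dense (C : set 'cV[R]_n) : dense (@nondegenerate R n d C).
Proof.
move=> O [g Og] oO.
have [ndg|dg] := pselect (nondegenerate C g); first by exists g.
have [x Sx gx] : exists2 x, unit_part C x & topform d g x = 0.
  move/not_orP: dg => [/existsNP[x /not_implyP[Sx /negP gx]] gN].
  exists x => //; apply/eqP; rewrite eq_le leNgt gx /= leNgt.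
  by apply/negP => lt_gx; apply: gN; exists x.
have [i xi] : exists i, x i 0 != 0.
  apply: contrapT => /forallNP x0; case: Sx => _ /= /eqP.
  have -> : x = 0.
    by apply/colP => i; rewrite mxE; apply/eqP; move/negP: (x0 i); rewrite negbK.
  by rewrite normr0 eq_sym oner_eq0.
(* The factor x_i^d makes the change at x equal to - e x_i^(2d), whatever the
   sign of x_i and the parity of d. *)
have [e e0 Oe] := open_line ((- x i 0 ^+ d) *: pow_var i) oO Og.
exists (g + e *: ((- x i 0 ^+ d) *: pow_var i)); split=> //; right; exists x => //=.
rewrite topformD !topformZ gx add0r topform_pow mulNr mulrN oppr_lt0.
by rewrite mulr_gt0 // -expr2 exprn_even_gt0 //= expf_neq0.
Qed.

(** Fixing one coefficient of degree d gives a smaller set than that of the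
    polynomials of degree d, but one that is still open and dense. *)
Definition full_degree i : set (poly_le R n d) :=
  [set g | (g : {mpoly R[n]})@_(U_(i) *+ d) != 0].

Lemma full_degree_msize i g : full_degree i g -> msize g = d.+1.
Proof.
move=> gi; have le_g : (msize g <= d.+1)%N := poly_leP g.
apply/eqP; rewrite eqn_leq le_g /=.
have := @msize_mdeg_lt _ _ (poly_le_val g) (U_(i) *+ d)%MM.
by rewrite mcoeff_msupp mdegMn mdeg1 mul1n; apply.
Qed.

Lemma full_degree_dense i : dense (full_degree i).
Proof.
move=> O [g Og] oO.
have [g0|gN0] := eqVneq (poly_le_val g)@_(U_(i) *+ d) 0; last by exists g.
have [e e0 Oe] := open_line (pow_var i) oO Og.
exists (g + e *: pow_var i); split=> //=.
by rewrite /full_degree /= mcoeffD mcoeffZ g0 add0r mcoeffXn eqxx mulr1 gt_eqF.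
Qed.

Lemma full_degree_open i : open (full_degree i).
Proof.
rewrite openE => g /= gi.
apply/nbhs_normP; exists `|(poly_le_val g)@_(U_(i) *+ d)|; first by rewrite /= normr_gt0.
move=> g' /=; apply: contraTneq => g'0; rewrite -leNgt.
by have := ler_coef_norm (g - g') (U_(i) *+ d)%MM; rewrite /= mcoeffB g'0 subr0.
Qed.

End Density.

(** * Regularity *)

(** Homogeneity leaves 0 as the only possible minimizer: a nonzero one is ruled
    out by comparison with 0 in the positive case, and by comparison with its
    own double in the negative case. *)
Lemma nondegenerate_regular (R : realType) (n d : nat) (K : set 'cV[R]_n)
    (g : poly_le R n d) : (0 < d)%N ->
  asymptotic_cone K 0 ->
  (forall a x, 0 < a -> asymptotic_cone K x -> asymptotic_cone K (a *: x)) ->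
  msize g = d.+1 -> nondegenerate (asymptotic_cone K) g -> regular K g.
Proof.
move=> d0 C0 CZ sg ndg.
suff Sol0 x : Sol (asymptotic_cone K) (lead_form g) x -> x = 0.
  exists 0; split=> [|M M0 x /= /Sol0 ->]; first exact: num_real.
  by rewrite normr0 ltW.
rewrite /Sol /lead_form sg /= -/(topform d g) => -[Cx minx].
have g00 : topform d g 0 = 0.
  by rewrite -[0 in LHS](scale0r 0) topform_homog expr0n gtn_eqF // mul0r.
case: ndg => [gpos|[y [Cy _] gy]].
  apply/eqP; apply: contraT => x0.
  have xN0 : 0 < `|x| by rewrite normr_gt0.
  have : 0 < topform d g (`|x|^-1 *: x).
    apply: gpos; split; first by apply: CZ; rewrite ?invr_gt0.
    by rewrite /= normrZ normfV normr_id mulVf ?gt_eqF.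
  rewrite topform_homog pmulr_rgt0 ?exprn_gt0 ?invr_gt0 //.
  by rewrite ltNge -g00 minx.
have lt_x0 : topform d g x < 0 by apply: le_lt_trans gy; exact: minx.
(* Doubling x multiplies a negative value by 2^d > 1. *)
have := minx _ (CZ 2 x _ Cx); rewrite -/(topform d g x) -/(topform d g (2 *: x)).
rewrite topform_homog -subr_le0 -{1}[topform d g x]mul1r -mulrBl ltr0n => /(_ isT).
by rewrite nmulr_lle0 // subr_ge0 leNgt exprn_egt1 ?ltr1n // gtn_eqF.
Qed.

(** * Genericity *)

Theorem theorem5p1 (R : realType) (n m p d : nat)
    (n_gt0 : (0 < n)%N) (d_ge2 : (2 <= d)%N)
    (q : 'I_m -> {mpoly R[n]}) (K : set 'cV[R]_n) (A : 'M[R]_(p, n))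
    (K_neq0 : K !=set0)
    (KE : K = [set x | forall i, peval (q i) x <= 0])
    (q_convex : forall i, convex_function setT (peval (q i)))
    (KinfE : asymptotic_cone K = [set x | forall i, 0 <= (A *m x) i 0])
    (A_full_rank : \rank A = minn p n) :
  generic [set g : poly_le R n d | msize g = d.+1 /\ regular K g].
Proof.
pose i0 := Ordinal n_gt0.
have clC : closed (asymptotic_cone K).
  rewrite KinfE.
  have -> : [set x : 'cV[R]_n | forall i, 0 <= (A *m x) i 0] =
      \bigcap_i [set x : 'cV[R]_n | 0 <= (A *m x) i 0].
    by apply/seteqP; split=> x /= Ax i; [move=> _|]; exact: Ax.
  apply: closed_bigI => i _.
  apply: (@preimage_closed 'cV[R]_n R (fun x => (A *m x) i 0) [set t | 0 <= t]);
    last exact: closed_ge.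
  move=> x _; under eq_fun do rewrite mxE.
  move: x; apply: continuous_big => [|j _]; first exact: add_continuous.
  by move=> x; apply: continuousM; [exact: cst_continuous|exact: coord_continuous].
exists (fun k => if k == 0%N then @full_degree R n d i0
                 else nondegenerate (asymptotic_cone K)).
split=> [[|k]|g gU] /=.
- by split; [exact: full_degree_open|exact: full_degree_dense].
- by split; [exact: nondegenerate_open|exact: nondegenerate_dense].
have sg := full_degree_msize (gU 0%N I); split=> //.
apply: nondegenerate_regular (gU 1%N I) => //.
- exact: ltnW.
- by rewrite KinfE => i /=; rewrite mulmx0 mxE.
- by move=> a x a0; rewrite KinfE => Cx i /=; rewrite -scalemxAr mxE mulr_ge0 // ltW.
Qed.
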